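(* Let $(E,d)$ be a Polish space and let the time set be $\mathbb{T}=\mathbb{N}$ or $\mathbb{T}=[0,\infty)$. For each $N=1,2,3,\dots$ let $Y^N=(Y^N(t))_{t\in\mathbb{T}}$ be an $E$-valued Feller process (with càdlàg sample paths if $\mathbb{T}=[0,\infty)$), and let $E^N\subset E$ be the support of $Y^N(0)$. Let $\varphi:\mathbb{T}\times E\to E$, $(t,y)\mapsto\varphi_t(y)$, be a continuous semi-flow. Assume that for every $y_0\in E$, every sequence $(y_0^N)_{N=1,2,\dots}$ with $y_0^N\in E^N$ for all $N$ and $\lim_{N\to\infty}y_0^N=y_0$, every $t\in\mathbb{T}$, and every bounded continuous $h:E\to\mathbb{R}$, $$\lim_{N\to\infty}\mathbb{E}^N\left[h(Y^N(t))\,\middle|\,Y^N(0)=y_0^N\right]=h(\varphi_t(y_0)).$$ For each $N$ let $\Pi^N$ be an invariant probability for $Y^N$. Then the support of any limit point (in the topology of weak convergence) of the sequence $(\Pi^N)_N$ is included in the closure of the recurrent set $$R(\varphi)=\{x\in E:\ \liminf_{t\to\infty}d(x,\varphi_t(x))=0\}.$$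
   Context: $\mathcal{P}(E)$ is the set of Borel probability measures on $E$ with the topology of weak convergence, and $\mathcal{C}_b(E)$ is the set of bounded continuous functions $E\to\mathbb{R}$. The process $Y^N$ is defined on a probability space $(\Omega^N,\mathcal{F}^N,\mathbb{P}^N)$, with expectation $\mathbb{E}^N$; $E^N$ is such that $\mathbb{P}^N(Y^N(0)\in E^N)=1$. The process is not required to be Markov. The process $Y^N$ comes with conditional laws of $Y^N(t)$ given $Y^N(0)=y$ for every initial value $y\in E$. Feller means: for every $t\in\mathbb{T}$ and $h\in\mathcal{C}_b(E)$, $y\mapsto\mathbb{E}^N[h(Y^N(t))\mid Y^N(0)=y]$ is a continuous function of $y\in E$. A probability $\Pi^N\in\mathcal{P}(E)$ is invariant for $Y^N$ if $\Pi^N(E^N)=1$ and for every $h\in\mathcal{C}_b(E)$ and every $t\in\mathbb{T}$, $$\int_E\mathbb{E}^N[h(Y^N(t))\mid Y^N(0)=y]\,\Pi^N(dy)=\int_E h(y)\,\Pi^N(dy).$$ $\varphi$ is a continuous semi-flow if $\varphi_0(y)=y$ for all $y\in E$, $\varphi_{s+t}=\varphi_s\circ\varphi_t$ for all $s,t\in\mathbb{T}$, and $\varphi_t(y)$ is continuous in $t$ and $y$. A limit point of a sequence is the limit of some subsequence.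
   Formalization: The convergence of E^N[h(Y^N(t)) | Y^N(0)=y_0^N] to h(φ_t(y_0)) is assumed along every subsequence (points y_0^{N_k} in E^{N_k} converging to y_0), not only for sequences indexed by all N; with the latter alone the claim is false. *)

(* Defs.v *)
From HB Require Import structures.
From mathcomp Require Import all_boot all_order all_algebra.
From mathcomp Require Import all_classical all_reals all_analysis.

Set Implicit Arguments.
Unset Strict Implicit.
Unset Printing Implicit Defensive.

Import Order.TTheory GRing.Theory Num.Theory.
Import numFieldNormedType.Exports.

Local Open Scope classical_set_scope.
Local Open Scope ring_scope.

HB.mixin Record isSeparable E & Topological E := {
  separable : exists D : set E, countable D /\ dense D }.

(* A Polish space with its metric [mdist]. The point carried by the structure
   is no restriction where a probability measure on [E] is present. *)
#[short(type="polishMetricType")]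
HB.structure Definition PolishMetric (R : numDomainType) :=
  { E of Metric R E & Complete E & isSeparable E }.

Notation borel E := (g_sigma_algebraType (@open E)).

(* Time is a subset of [R]: the naturals or the half-line. Functions of time
   are total on [R]; their values outside the time set are irrelevant. *)
Definition nat_time (R : realType) : set R := range (fun n : nat => n%:R).
Definition real_time (R : realType) : set R := [set t | 0 <= t].
Arguments nat_time R : clear implicits.
Arguments real_time R : clear implicits.

Section defs.
Context {R : realType} {E : polishMetricType R}.
Implicit Types (T : set R) (h : E -> R) (phi : R -> E -> E).

Definition Cb : set (E -> R) := [set h | continuous h /\ bounded_fun h].

Definition msupport (mu : probability (borel E) R) : set E :=
  [set x | forall U : set E, open U -> U x -> (0 < mu U)%E].

Definition weak_cvg (mu_ : nat -> probability (borel E) R)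
    (mu : probability (borel E) R) : Prop :=
  forall h, Cb h ->
    (\int[mu_ n]_x h x) @[n --> \oo] --> (\int[mu]_x h x : R).

Definition strictly_increasing (s : nat -> nat) : Prop :=
  {homo s : m n / (m < n)%N}.

Definition weak_limit_point (mu_ : nat -> probability (borel E) R)
    (mu : probability (borel E) R) : Prop :=
  exists2 s, strictly_increasing s & weak_cvg (mu_ \o s) mu.

Definition continuous_semiflow T phi : Prop :=
  [/\ forall y, phi 0 y = y,
      forall s t, T s -> T t -> forall y, phi (s + t) y = phi s (phi t y) &
      {within T `*` [set: E], continuous (fun ty : R * E => phi ty.1 ty.2)}].

Definition recurrent_set T phi : set E :=
  [set x | limf_einf (fun t : R => (mdist x (phi t x))%:E)
             (within T (+oo : set_system R)) = 0%E].

Definition cadlag (f : R -> E) : Prop :=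
  (forall t, 0 <= t -> f x @[x --> t^'+] --> f t) /\
  (forall t, 0 < t -> exists l : E, f x @[x --> t^'-] --> l).

(* [k] is a regular version of the conditional law of [Z] given [X]. *)
Definition conditional_law d (Om : measurableType d) (P : probability Om R)
    (X Z : {RV P >-> borel E}) (k : R.-pker (borel E) ~> (borel E)) : Prop :=
  forall A B : set (borel E), measurable A -> measurable B ->
    P (X @^-1` A `&` Z @^-1` B) = (\int[distribution P X]_(y in A) k y B)%E.

(* E[h(Y(t)) | Y(0) = y], for [K t y] the conditional law of Y(t) given
   Y(0) = y. *)
Definition cond_expectation (K : R -> R.-pker (borel E) ~> (borel E))
    (t : R) h (y : E) : R := \int[K t y]_z h z.

Definition feller T (K : R -> R.-pker (borel E) ~> (borel E)) : Prop :=
  forall t h, T t -> Cb h -> continuous (cond_expectation K t h).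

Definition invariant_probability T (S : set E)
    (K : R -> R.-pker (borel E) ~> (borel E))
    (Pi : probability (borel E) R) : Prop :=
  Pi S = 1%E /\
  forall h t, Cb h -> T t ->
    \int[Pi]_y cond_expectation K t h y = \int[Pi]_y h y :> R.

Definition converges_to_semiflow T (S : nat -> set E)
    (K : nat -> R -> R.-pker (borel E) ~> (borel E)) phi : Prop :=
  forall (y0 : E) (y : nat -> E),
    (forall N, S N (y N)) -> y N @[N --> \oo] --> y0 ->
    forall t h, T t -> Cb h ->
      cond_expectation (K N) t h (y N) @[N --> \oo] --> h (phi t y0).

(* Convergence is required along every subsequence (sequences of initial
   conditions y^{N_k} in S (N_k)), the limit points of the invariant
   probabilities being themselves limits along subsequences. Asking for it only
   for sequences indexed by all N says nothing about an initial condition y0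
   that is approached by S N for, say, even N only. For example, with E the real
   line, all processes constant in time, phi t y = exp (- t) * y, S N = {0} for
   odd N and S N = E for even N, it only concerns y0 = 0, where it holds,
   although every probability is invariant for the even-indexed processes. *)
Definition converges_to_semiflow_along_subsequences T (S : nat -> set E)
    (K : nat -> R -> R.-pker (borel E) ~> (borel E)) phi : Prop :=
  forall s, strictly_increasing s ->
    converges_to_semiflow T (S \o s) (K \o s) phi.

End defs.

(* Main.v *)
Require Import Defs.
From HB Require Import structures.
From mathcomp Require Import all_boot all_order all_algebra.
From mathcomp Require Import all_classical all_reals all_analysis.
From mathcomp Require Import measurable_realfun lra.

Set Implicit Arguments.
Unset Strict Implicit.
Unset Printing Implicit Defensive.

Import Order.TTheory GRing.Theory Num.Theory.
Import numFieldNormedType.Exports.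

Local Open Scope classical_set_scope.
Local Open Scope ring_scope.

(** A weak limit [mu] of the invariant probabilities is itself invariant under
    the semi-flow, and Poincare recurrence then provides a recurrent point in
    every open set that [mu] charges.

    Invariance of [mu] (lemma [continuously_cvg_integral]). Fix a time [t] and a
    bounded continuous [h], and write [g_ n] for the conditional expectation of
    [h] at time [t] given the initial value. The invariance of [Pi n] says that
    [g_ n] and [h] have the same integral against it, so it suffices that these
    integrals of [g_ n] converge, along the subsequence, to the integral of
    [h \o phi t] against [mu]. The hypothesis is that [g_ n] converges
    continuously to [h \o phi t] along the supports, that is, at all convergent
    sequences of points of the supports. Such a convergence is uniform near
    each point: the open sets [O m] on which, at the points of the supports,
    [g_ n] is within [e] of its limit for all [n >= m] increase to the whole
    space. Some [O m] then has [mu]-measure close to 1, and a continuous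
    function below its indicator shows that, for large [n], the [n]-th measure
    gives it almost full mass as well. This replaces the tightness or the
    Skorokhod representation of the usual proofs of the extended mapping
    theorem.

    Recurrence (lemma [Poincare_recurrence]). Along integer times the flow
    preserves the [mu]-measure of open sets (lemma [open_preimage_invariant]),
    and that is enough: for [V] open and [M] fixed, the points of [V] that
    return to [V] at no positive multiple of [M] lie in the difference of two
    nested sets of equal measure, the open set of points visiting [V] at some
    multiple of [M] and its preimage at time [M]. Taking [V] in a countable
    family of small balls, almost every point returns arbitrarily late and
    arbitrarily close to itself. *)

(** * Bounded continuous functions and Borel probabilities *)

Lemma open_borel_measurable {R : realType} {E : polishMetricType R}
    (U : set E) : open U -> measurable (U : set (borel E)).
Proof. by move=> oU; exact: sub_sigma_algebra. Qed.

Lemma continuous_borel_measurable {R : realType} {E : polishMetricType R}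
    (f : E -> R) : continuous f -> measurable_fun setT (f : borel E -> R).
Proof.
move=> /continuousP cf.
apply: (measurability _ (RGenOInfty.measurableE R)) => _ [_ [a ->] <-].
by rewrite setTI; apply: open_borel_measurable; apply: cf; exact: interval_open.
Qed.

Lemma CbP {R : realType} {E : polishMetricType R} (h : E -> R) :
  Cb h <-> continuous h /\ exists M : R, forall x, `|h x| <= M.
Proof.
split=> [[ch /pinfty_ex_gt0[M _ bM]]|[ch [M bM]]].
  by split=> //; exists M => x; exact: bM.
split=> //; rewrite /bounded_near; near=> K => x _ /=.
by rewrite (le_trans (bM x)).
Unshelve. all: by end_near.
Qed.

Lemma Cb_integrable {R : realType} {E : polishMetricType R}
    (mu : {measure set (borel E) -> \bar R}) (h : E -> R) :
  (mu setT < +oo)%E -> Cb h -> mu.-integrable setT (EFin \o h).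
Proof.
move=> mufin [ch bh]; apply: measurable_bounded_integrable => //.
exact: continuous_borel_measurable.
Qed.

Lemma Cb_integrable_prob {R : realType} {E : polishMetricType R}
    (mu : probability (borel E) R) (h : E -> R) :
  Cb h -> mu.-integrable setT (EFin \o h).
Proof. by apply: Cb_integrable; rewrite ltey_eq fin_num_measure. Qed.

Lemma CbB {R : realType} {E : polishMetricType R} (f g : E -> R) :
  Cb f -> Cb g -> Cb (fun x => f x - g x).
Proof.
move=> /CbP[cf [M fM]] /CbP[cg [N gN]]; apply/CbP; split.
  by move=> x; apply: continuousB; [exact: cf|exact: cg].
by exists (M + N) => x; rewrite (le_trans (ler_normB _ _))// lerD.
Qed.

Lemma Cb_norm {R : realType} {E : polishMetricType R} (f : E -> R) :
  Cb f -> Cb (fun x => `|f x|).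
Proof.
move=> /CbP[cf [M fM]]; apply/CbP; split.
  by move=> x; apply: cvg_norm; exact: cf.
by exists M => x; rewrite normr_id.
Qed.

Lemma CbZ {R : realType} {E : polishMetricType R} (k : R) (f : E -> R) :
  Cb f -> Cb (fun x => k * f x).
Proof.
move=> /CbP[cf [M fM]]; apply/CbP; split.
  by move=> x; apply: cvgMl_tmp; exact: cf.
by exists (`|k| * M) => x; rewrite normrM ler_wpM2l.
Qed.

Lemma Cb_cst {R : realType} {E : polishMetricType R} (k : R) :
  Cb (fun _ : E => k).
Proof. by apply/CbP; split; [move=> x; exact: cvg_cst|exists `|k|]. Qed.

Lemma Cb_comp {R : realType} {E : polishMetricType R} (h : E -> R)
    (g : E -> E) : continuous g -> Cb h -> Cb (h \o g).
Proof.
move=> cg /CbP[ch [M hM]]; apply/CbP; split; last by exists M => x; exact: hM.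
by move=> x; apply: continuous_comp; [exact: cg|exact: ch].
Qed.

Lemma le_Rintegral_full {R : realType} {E : polishMetricType R}
    (mu : probability (borel E) R) (A : set (borel E)) (f g : E -> R) :
  measurable A -> mu A = 1%E -> Cb f -> Cb g ->
  (forall x, A x -> f x <= g x) ->
  \int[mu]_x f x <= \int[mu]_x g x.
Proof.
move=> mA A1 Cf Cg fg.
have muN : mu (~` A) = 0%E by rewrite probability_setC// A1 subee.
have restr h : Cb h -> \int[mu]_x h x = \int[mu]_(x in A) h x.
  move=> Ch; rewrite /Rintegral (negligible_integral _ _ _ muN)//.
  - by rewrite setTD setCK.
  - exact: measurableC.
  - exact: Cb_integrable_prob.
rewrite (restr f)// (restr g)//; apply: le_Rintegral => //.
- apply: (integrableS measurableT) => //; exact: Cb_integrable_prob.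
- apply: (integrableS measurableT) => //; exact: Cb_integrable_prob.
Qed.

(** * Continuous approximation of indicators of open sets *)

(** The distance to [A] scaled by [k] and truncated at 1, a [k]-Lipschitz
    function vanishing on [A]. Putting 1 in the set gives the value 1
    everywhere when [A] is empty. *)
Definition gap {R : realType} {E : polishMetricType R} (k : R) (A : set E)
    (x : E) : R :=
  inf ([set 1] `|` [set k * mdist x a | a in A]).

Section gap.
Context {R : realType} {E : polishMetricType R} (k : R) (A : set E).
Hypothesis k0 : 0 <= k.

Let gap_set x : set R := [set 1] `|` [set k * mdist x a | a in A].

Let gap_lb0 x : lbound (gap_set x) 0.
Proof. by move=> _ [->//|[a _ <-]]; rewrite mulr_ge0// mdist_ge0. Qed.

Let gap_ne x : gap_set x !=set0. Proof. by exists 1; left. Qed.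

Lemma gap_ge x r : r <= 1 -> (forall a, A a -> r <= k * mdist x a) ->
  r <= gap k A x.
Proof.
move=> r1 rA; apply: lb_le_inf; first exact: gap_ne.
by move=> _ [->//|[a Aa <-]]; exact: rA.
Qed.

Lemma gap_ge0 x : 0 <= gap k A x.
Proof. by apply: gap_ge => // a Aa; rewrite mulr_ge0// mdist_ge0. Qed.

Lemma gap_le1 x : gap k A x <= 1.
Proof. by apply: ge_inf; [exists 0; exact: gap_lb0|left]. Qed.

Lemma gap_le_mdist x a : A a -> gap k A x <= k * mdist x a.
Proof.
by move=> Aa; apply: ge_inf; [exists 0; exact: gap_lb0|right; exists a].
Qed.

Lemma gap_eq0 x : A x -> gap k A x = 0.
Proof.
move=> /(gap_le_mdist x); rewrite mdistxx mulr0 => g0.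
by apply/eqP; rewrite eq_le g0 gap_ge0.
Qed.

Lemma gap_continuous : continuous (gap k A).
Proof.
have lip x y : gap k A x - gap k A y <= k * mdist x y.
  rewrite lerBlDl -lerBlDr; apply: gap_ge.
    by rewrite lerBlDl (le_trans (gap_le1 x))// lerDr mulr_ge0// mdist_ge0.
  move=> a Aa; rewrite lerBlDl (le_trans (gap_le_mdist x Aa))//.
  by rewrite -mulrDr ler_wpM2l// metric_triangle.
move=> x; apply/cvgrPdist_lt => e e0.
have k1 : 0 < k + 1 by rewrite ltr_wpDl.
have : \forall y \near x, mdist x y < e / (k + 1).
  have /metricType_numDomainType.cvgrPdist_lt : y @[y --> x] --> x by [].
  by apply; rewrite divr_gt0.
apply: filterS => y xy.
apply: (@le_lt_trans _ _ (k * mdist x y)).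
  by rewrite ler_norml lip andbT lerNl opprB metric_sym lip.
move: xy; rewrite ltr_pdivlMr// mulrC => /(le_lt_trans _); apply.
by rewrite mulrDl mul1r lerDl mdist_ge0.
Qed.

Lemma Cb_gap : Cb (gap k A).
Proof.
apply/CbP; split; first exact: gap_continuous.
by exists 1 => x; rewrite ger0_norm ?gap_le1// gap_ge0.
Qed.

End gap.

(** Letting the set and the slope vary together makes one sequence serve two
    purposes: with [O] constant it approximates the indicator of an open set
    from below, and with [O] increasing to the whole space it provides, for
    some index, a function supported in [O m] whose integral is close to 1. *)
Lemma gap_cvg_indic {R : realType} {E : polishMetricType R}
    (O : nat -> set E) (x : E) :
  (forall m, open (O m)) -> {homo O : m n / (m <= n)%N >-> m `<=` n} ->
  gap m%:R (~` O m) x @[m --> \oo] --> (\1_(\bigcup_m O m) x : R).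
Proof.
move=> oO ndO; rewrite indicE.
have [|xO] := boolP (x \in _); last first.
  apply: cvg_near_cst; apply: nearW => m; apply: gap_eq0 => // xOm.
  by move/negP : xO; apply; rewrite inE; exists m.
rewrite inE => -[m _ Omx].
have [r /= r0 rO] := (nbhs_ballP _ _).1 (open_nbhs_nbhs (conj (oO m) Omx)).
apply: cvg_near_cst; near=> n.
apply/eqP; rewrite eq_le gap_le1//=; apply: gap_ge => // a Oa.
have ra : r <= mdist x a.
  rewrite leNgt; apply/negP => xa; apply: Oa.
  have mn : (m <= n)%N by near: n; exact: nbhs_infty_ge.
  by apply: (ndO _ _ mn); apply: rO; rewrite ballEmdist.
apply: (@le_trans _ _ (n%:R * r)); last by rewrite ler_wpM2l.
rewrite -ler_pdivrMr// mul1r; near: n; exact: nbhs_infty_ger.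
Unshelve. all: by end_near. Qed.

Lemma gap_integral_cvg {R : realType} {E : polishMetricType R}
    (mu : probability (borel E) R) (g : E -> E) (O : nat -> set E) :
  continuous g ->
  (forall m, open (O m)) -> {homo O : m n / (m <= n)%N >-> m `<=` n} ->
  \int[mu]_x gap m%:R (~` O m) (g x) @[m --> \oo]
    --> fine (mu (g @^-1` \bigcup_m O m)).
Proof.
move=> cg oO ndO.
have oW : open (\bigcup_m O m) by apply: bigcup_open.
have mW : measurable (g @^-1` (\bigcup_m O m) : set (borel E)).
  by apply: open_borel_measurable; move/continuousP: cg; exact.
have cgap m : continuous (fun x => gap m%:R (~` O m) (g x)).
  move=> x; apply: (@continuous_comp _ _ _ g (gap m%:R (~` O m))).
    exact: cg.
  exact: gap_continuous.
have muW : mu (g @^-1` (\bigcup_m O m)) =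
    (\int[mu]_x (\1_(\bigcup_m O m) (g x))%:E)%E.
  by rewrite -[in LHS](setIT (g @^-1` _)) -integral_indic//.
apply: fine_cvg; rewrite fineK ?fin_num_measure// muW.
apply: (@dominated_cvg _ _ _ mu setT _ _ _ (cst 1%E)) => //.
- by move=> m; apply/measurable_EFinP; exact: continuous_borel_measurable.
- by move=> x _; apply: cvg_EFin; [exact: nearW|exact: gap_cvg_indic].
- exact: finite_measure_integrable_cst.
- by move=> m x _ /=; rewrite lee_fin ger0_norm ?gap_le1// gap_ge0.
Qed.
Arguments gap_integral_cvg {R E} mu {g O}.

(** * Integrals along weak and continuous convergence *)

(** The subsequences [s] matter: points of [S n] may approach [y0] along some
    indices [n] only. *)
Definition converges_continuously {R : realType} {E : polishMetricType R}
    (S : nat -> set E) (g_ : nat -> E -> R) (g : E -> R) : Prop :=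
  forall s, strictly_increasing s ->
  forall (y0 : E) (y : nat -> E), (forall k, S (s k) (y k)) ->
    y k @[k --> \oo] --> y0 -> g_ (s k) (y k) @[k --> \oo] --> g y0.

(** Otherwise, for every [k], some point of some [S n] with [n >= k], within
    [1 / (k + 1)] of [y0], violates the bound; a strictly increasing choice of
    the indices [n] contradicts the convergence. *)
Lemma converges_continuously_near {R : realType} {E : polishMetricType R}
    (S : nat -> set E) (g_ : nat -> E -> R) (g : E -> R) (y0 : E) (e : R) :
  converges_continuously S g_ g -> 0 < e ->
  exists m, \forall z \near y0, forall n, (m <= n)%N -> S n z ->
    `|g_ n z - g y0| < e.
Proof.
move=> cvg_g e0; apply: contrapT => H.
have far k : exists nz : nat * E, [/\ (k <= nz.1)%N,
    ball y0 k.+1%:R^-1 nz.2, S nz.1 nz.2 & e <= `|g_ nz.1 nz.2 - g y0|].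
  apply: contrapT => Hk; apply: H; exists k.
  apply/nbhs_ballP; exists k.+1%:R^-1 => /=; first by rewrite invr_gt0.
  move=> z y0z n kn Sz; rewrite ltNge; apply/negP => ez.
  by apply: Hk; exists (n, z).
have [c cP] := choice far.
(* [p k] is the rank from which the [k]-th index is sought; restarting just
   above the previous index makes the indices [s k] strictly increasing. *)
pose p := fix p k := if k is k'.+1 then (c (p k')).1.+1 else 0%N.
pose s k := (c (p k)).1; pose y k := (c (p k)).2.
have ps k : (p k <= s k)%N by have [] := cP (p k).
have pk k : (k <= p k)%N.
  by elim: k => // k IH; rewrite /= ltnS (leq_trans IH)// ps.
have s_incr : strictly_increasing s.
  by apply: homo_ltn => [? ? ?|k]; [exact: ltn_trans|exact: ps k.+1].
have y_y0 : y k @[k --> \oo] --> y0.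
  apply/cvg_ballP => r r0; near=> k.
  have [_ + _ _] := cP (p k); apply: le_ball.
  apply: (@le_trans _ _ k.+1%:R^-1).
    by rewrite lef_pV2 ?posrE// ler_nat ltnS pk.
  by rewrite ltW//; near: k; exact: (near_infty_natSinv_lt (PosNum r0)).
have Sy k : S (s k) (y k) by have [] := cP (p k).
have /cvgrPdist_lt/(_ e e0) := cvg_g s s_incr y0 y Sy y_y0.
move=> [k _ /(_ k (leqnn k))] /=; rewrite distrC.
by have [_ _ _] := cP (p k); rewrite leNgt => /negP.
Unshelve. all: by end_near. Qed.

(** On the part of [S n] in [O m], the difference of [g_ n] and [g] is small;
    elsewhere it is at most [2 * M], which is [2 * M * (1 - f)] for [f] a
    continuous function between 0 and the indicator of [O m]. Weak convergence
    applied to [f] makes the integral of [1 - f] small. *)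
Lemma continuously_cvg_integral {R : realType} {E : polishMetricType R}
    (mu_ : nat -> probability (borel E) R) (mu : probability (borel E) R)
    (S : nat -> set E) (g_ : nat -> E -> R) (g : E -> R) (M : R) :
  weak_cvg mu_ mu ->
  (forall n, measurable (S n : set (borel E))) ->
  (forall n, mu_ n (S n) = 1%E) ->
  (forall n, Cb (g_ n)) -> (forall n x, `|g_ n x| <= M) ->
  Cb g -> (forall x, `|g x| <= M) ->
  converges_continuously S g_ g ->
  \int[mu_ n]_x g_ n x @[n --> \oo] --> (\int[mu]_x g x : R).
Proof.
move=> mu_mu mS S1 Cg_ g_M Cg gM cvg_g.
have M0 : 0 <= M by rewrite (le_trans _ (gM point)).
apply/cvgrPdist_lt => e e0.
pose e4 := e / 4; have e40 : 0 < e4 by rewrite divr_gt0.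
pose O m := interior [set z | forall n, (m <= n)%N -> S n z ->
                        `|g_ n z - g z| < e4].
have oO m : open (O m) by exact: open_interior.
have ndO : {homo O : m n / (m <= n)%N >-> m `<=` n}.
  move=> m n mn; apply: interiorS => z /= + k nk; apply.
  exact: leq_trans nk.
have OT : \bigcup_m O m = setT.
  rewrite -subTset => y0 _.
  have e20 : 0 < e4 / 2 by rewrite divr_gt0.
  have [m near_m] := converges_continuously_near y0 cvg_g e20.
  exists m => //; rewrite /O /interior.
  have near_g : \forall z \near y0, `|g y0 - g z| < e4 / 2.
    by have [cg _] := Cg; have /cvgrPdist_lt := cg y0; exact.
  apply: filterS2 near_m near_g => z gz g0z n mn Snz.
  rewrite -(subrKA (g y0)) (le_lt_trans (ler_normD _ _))//.
  by rewrite (splitr e4) ltrD// gz.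
(* This gives [2 * M * delta <= e4]; adding 1 covers the case [M = 0]. *)
pose delta := e4 / (2 * M + 1).
have M1 : 0 < 2 * M + 1 by rewrite ltr_wpDl// mulr_ge0.
have delta0 : 0 < delta by rewrite divr_gt0.
have [m mum] : exists m, 1 - delta < \int[mu]_x gap m%:R (~` O m) x.
  have id_cont : continuous (@id E) by move=> x; exact: cvg_id.
  have := gap_integral_cvg mu id_cont oO ndO.
  rewrite OT preimage_setT (@probability_setT _ _ _ mu) /=.
  move=> /cvgrPdist_lt/(_ _ delta0)[m _ /(_ m (leqnn m))] /= H.
  by exists m; move: H; rewrite ltr_distlC => /andP[].
set f := gap m%:R (~` O m) in mum.
have Cf : Cb f by exact: Cb_gap.
have near_f : \forall n \near \oo, 1 - delta < \int[mu_ n]_x f x.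
  by apply: cvgr_gt mum; exact: mu_mu.
have near_g : \forall n \near \oo,
    `|\int[mu]_x g x - \int[mu_ n]_x g x| < e4.
  by have /cvgrPdist_lt := mu_mu g Cg; exact.
near=> n.
have fn : 1 - delta < \int[mu_ n]_x f x by near: n.
have gn : `|\int[mu]_x g x - \int[mu_ n]_x g x| < e4 by near: n.
have mn : (m <= n)%N by near: n; exact: nbhs_infty_ge.
have diff : `|\int[mu_ n]_x g_ n x - \int[mu_ n]_x g x|
    <= (e4 + 2 * M) - 2 * M * \int[mu_ n]_x f x.
  rewrite -RintegralB//; [|exact: Cb_integrable_prob..].
  rewrite (le_trans (le_normr_Rintegral _ _))//.
    by apply: (@Cb_integrable_prob _ _ (mu_ n)); exact: CbB.
  apply: (@le_trans _ _ (\int[mu_ n]_x (e4 + 2 * M - 2 * M * f x))).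
    apply: (le_Rintegral_full (mS n) (S1 n)).
    - by apply: Cb_norm; exact: CbB.
    - by apply: CbB; [exact: Cb_cst|exact: CbZ].
    move=> x Sx; have [Ox|Ox] := pselect (O m x).
      have := interior_subset Ox => /(_ n mn Sx) /ltW /le_trans; apply.
      rewrite -addrA lerDl -{1}(mulr1 (2 * M)) -mulrBr mulr_ge0//.
        by rewrite mulr_ge0.
      by rewrite subr_ge0 gap_le1.
    rewrite /f gap_eq0// mulr0 subr0 (le_trans (ler_normB _ _))//.
    have := g_M n x; have := gM x; lra.
  rewrite RintegralB//; [|exact: (Cb_integrable_prob _ (Cb_cst _))|].
    rewrite Rintegral_cst// RintegralZl//; last exact: Cb_integrable_prob.
    have muT : mu_ n [set: borel E] = 1%E by exact: probability_setT.
    by rewrite [fine _](congr1 fine muT) mulr1.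
  by apply: (@Cb_integrable_prob _ _ (mu_ n)); exact: CbZ.
have small : 2 * M * (1 - \int[mu_ n]_x f x) <= e4.
  apply: (@le_trans _ _ (2 * M * delta)).
    by rewrite ler_wpM2l ?mulr_ge0//; lra.
  have -> : e4 = delta * (2 * M + 1) by rewrite divfK// gt_eqF.
  by rewrite [leLHS]mulrC ler_pM2l// lerDl.
have e44 : e = e4 * 4 by rewrite /e4 divfK.
rewrite -(subrKA (\int[mu_ n]_x g x)) (le_lt_trans (ler_normD _ _))//.
rewrite [X in _ + X]distrC; lra.
Unshelve. all: by end_near. Qed.

(** * Poincare recurrence *)

(** Both sides are limits of the integrals of the same functions [gap m], before
    and after composition with [g]. *)
Lemma open_preimage_invariant {R : realType} {E : polishMetricType R}
    (mu : probability (borel E) R) (g : E -> E) (U : set E) :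
  continuous g ->
  (forall h, Cb h -> \int[mu]_x h (g x) = \int[mu]_x h x :> R) ->
  open U -> mu (g @^-1` U) = mu U.
Proof.
move=> cg inv oU.
have cid : continuous (@id E) by move=> x; exact: cvg_id.
have ndU : {homo (fun=> U) : m n / (m <= n)%N >-> m `<=` n}.
  by move=> m n _ x.
have UE : \bigcup_(_ : nat) U = U by apply: bigcup_const; exists 0%N.
have := gap_integral_cvg mu cg (fun=> oU) ndU.
have -> : (fun m : nat => \int[mu]_x gap m%:R (~` U) (g x) : R) =
          (fun m : nat => \int[mu]_x gap m%:R (~` U) x : R).
  by apply/funext => m; apply: inv; exact: Cb_gap.
move=> limg; have limid := gap_integral_cvg mu cid (fun=> oU) ndU.
have := cvg_unique _ limg limid; rewrite UE preimage_id => /(_ _) eqf.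
have fin A : measurable (A : set (borel E)) -> mu A \is a fin_num.
  by move=> mA; exact: fin_num_measure.
rewrite -[LHS]fineK; last first.
  by apply: fin; apply: open_borel_measurable; move/continuousP: cg; exact.
rewrite -[RHS]fineK; last by apply: fin; exact: open_borel_measurable.
by rewrite eqf.
Qed.

Section recurrence.
Context {R : realType} {E : polishMetricType R}.
Variables (mu : probability (borel E) R) (psi : nat -> E -> E).
Hypothesis psi0 : forall x, psi 0%N x = x.
Hypothesis psiD : forall m n x, psi (m + n)%N x = psi m (psi n x).
Hypothesis psi_cont : forall n, continuous (psi n).
Hypothesis psi_inv : forall n U, open U -> mu (psi n @^-1` U) = mu U.

Let open_psi n V : open V -> open (psi n @^-1` V).
Proof. by move=> oV; have /continuousP := @psi_cont n; exact. Qed.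

(** [G], the points visiting [V] at a time [k * M], contains [V] and its own
    preimage [W] at time [M], the points visiting [V] at a time
    [(k + 1) * M]. So [V] minus [W] is inside [G] minus [W], which is null
    because the measure of the open set [G] is invariant. *)
Lemma never_returning_null (M : nat) (V : set E) : open V ->
  mu.-negligible (V `\` \bigcup_k (psi (k.+1 * M)%N @^-1` V)).
Proof.
move=> oV.
pose G := \bigcup_k (psi (k * M)%N @^-1` V).
have oG : open G by apply: bigcup_open => k _; exact: open_psi.
have GE : psi M @^-1` G = \bigcup_k (psi (k.+1 * M)%N @^-1` V).
  rewrite preimage_bigcup; apply: eq_bigcupr => k _.
  by apply/seteqP; split=> x /=; rewrite mulSn addnC psiD.
rewrite -GE; set W := psi M @^-1` G.
have oW : open W by exact: open_psi.
have mG : measurable (G : set (borel E)) by exact: open_borel_measurable.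
have mW : measurable (W : set (borel E)) by exact: open_borel_measurable.
have WG : W `<=` G by rewrite /W GE => x [k _ Vx]; exists k.+1.
exists (G `\` W); split; first exact: measurableD.
- rewrite measureD//; last by rewrite ltey_eq fin_num_measure.
  rewrite (setIidr WG) [X in (_ - X)%E](psi_inv _ oG) subee//.
  exact: fin_num_measure.
- by move=> x [Vx nWx]; split=> //; exists 0%N => //; rewrite /= mul0n psi0.
Qed.

(** Apply [never_returning_null] to a countable family of balls of radius
    [1 / (j + 1)] centred at a dense sequence, and to all [M], so that the
    return times can be taken late. *)
Lemma Poincare_recurrence (U : set E) : open U -> (0 < mu U)%E ->
  exists2 x, U x & forall (e : R) (M : nat), 0 < e ->
    exists2 n, (M <= n)%N & mdist x (psi n x) < e.
Proof.
move=> oU muU.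
have [D [cD dD]] := @separable _ E.
have [q qD] : exists q : nat -> E, D `<=` range q.
  have [->|[f]] := (pfcard_geP cD); first by exists (fun=> point).
  by exists f => x Dx; have [n _ fn] := @surj _ _ _ _ f x Dx; exists n.
pose V i j : set E := interior (ball (q i) j.+1%:R^-1).
pose B i j M := V i j `\` \bigcup_k (psi (k.+1 * M)%N @^-1` V i j).
pose bad := \bigcup_i \bigcup_j \bigcup_M B i j M.
have bad0 : mu.-negligible bad.
  apply: negligible_bigcup => i; apply: negligible_bigcup => j.
  apply: negligible_bigcup => M.
  by apply: never_returning_null; exact: open_interior.
have [x [Ux nbx]] : exists x, U x /\ ~ bad x.
  apply: contrapT => H; move: muU; rewrite lt_neqAle => /andP[/eqP + _].
  apply; apply/esym/negligibleP; first exact: open_borel_measurable.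
  apply: negligibleS bad0 => x Ux; apply: contrapT => nbx.
  by apply: H; exists x.
exists x => // e M e0.
have [j je] : exists j : nat, j.+1%:R^-1 < e / 2.
  have e20 : 0 < e / 2 by rewrite divr_gt0.
  have [j _ /(_ j (leqnn j))] := near_infty_natSinv_lt (PosNum e20).
  by exists j.
have j0 : (0 : R) < j.+1%:R^-1 by rewrite invr_gt0.
pose r : R := j.+1%:R^-1.
have r20 : 0 < r / 2 by rewrite divr_gt0.
have xx : interior (ball x (r / 2)) x.
  by apply/nbhs_ballP; exists (r / 2).
have [y [/interior_subset xy Dy]] :=
  dD _ (ex_intro _ x xx) (open_interior (ball x (r / 2))).
have [i _ qi] := qD y Dy.
have Vx : V i j x.
  apply/nbhs_ballP; exists (r / 2) => //= z xz.
  by rewrite qi /= -/r; apply: ball_split xz; exact: ball_sym.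
have [k _ Vkx] : (\bigcup_k (psi (k.+1 * M)%N @^-1` V i j)) x.
  apply: contrapT => nVx; apply: nbx.
  by exists i => //; exists j => //; exists M.
exists (k.+1 * M)%N; first by rewrite mulSn leq_addr.
have half z : V i j z -> ball (q i) (e / 2) z.
  by move=> /interior_subset; apply: le_ball; exact: ltW.
by have := ball_splitr (half _ Vx) (half _ Vkx); rewrite ballEmdist.
Qed.
End recurrence.

(** * The conditional expectations and the semi-flow *)

(** Late close returns at integer times, which belong to both time sets, bring
    the lower limit over all times of [T] down to 0. *)
Lemma integer_recurrence {R : realType} {E : polishMetricType R} (T : set R)
    (phi : R -> E -> E) (x : E) :
  (forall n : nat, T n%:R) ->
  (forall (e : R) (M : nat), 0 < e ->
    exists2 n, (M <= n)%N & mdist x (phi n%:R x) < e) ->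
  recurrent_set T phi x.
Proof.
move=> Tn rec; rewrite /recurrent_set /= limf_einfE.
apply/eqP; rewrite eq_le; apply/andP; split.
  apply: ge_ereal_sup => _ [V [A [_ AV]] <-].
  apply/lee_addgt0Pr => e e0; rewrite add0e.
  have [n An ne] := rec e (Num.trunc `|A|).+1 e0.
  apply: (@le_trans _ _ (mdist x (phi n%:R x))%:E); last first.
    by rewrite lee_fin ltW.
  apply: ereal_inf_lbound; exists n%:R => //; apply: AV => //.
  rewrite (le_lt_trans (ler_norm A))// (lt_le_trans (truncnS_gt _))//.
  by rewrite ler_nat.
apply: (@le_trans _ _ (ereal_inf ((fun t => (mdist x (phi t x))%:E) @` setT))).
  by apply: le_ereal_inf_tmp => _ [t _ <-]; rewrite lee_fin mdist_ge0.
by apply: ereal_sup_ubound; exists setT => //; exact: filterT.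
Qed.

Lemma closed_msupport {R : realType} {E : polishMetricType R}
    (mu : probability (borel E) R) : closed (msupport mu).
Proof.
move=> x clx U oU Ux.
have [y [sy Uy]] := clx U (open_nbhs_nbhs (conj oU Ux)).
exact: sy.
Qed.

Lemma norm_Rintegral_le {R : realType} {E : polishMetricType R}
    (k : R.-pker (borel E) ~> (borel E)) (y : E) (h : E -> R) (M : R) :
  continuous h -> (forall x, `|h x| <= M) -> `|\int[k y]_x h x| <= M.
Proof.
move=> ch hM.
have ky : k y setT = 1%E by exact: prob_kernel.
have bint (f : E -> R) : Cb f -> (k y).-integrable setT (EFin \o f).
  by apply: Cb_integrable; rewrite ky ltry.
have Ch : Cb h by apply/CbP; split=> //; exists M.
rewrite (le_trans (le_normr_Rintegral _ _))//; first exact: bint.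
apply: (@le_trans _ _ (\int[k y]_x M)).
  by apply: le_Rintegral => //; [exact/bint/Cb_norm|exact/bint/Cb_cst].
by rewrite Rintegral_cst// [fine _](congr1 fine ky) mulr1.
Qed.

Lemma semiflow_continuous {R : realType} {E : polishMetricType R} (T : set R)
    (phi : R -> E -> E) (t : R) :
  continuous_semiflow T phi -> T t -> continuous (phi t).
Proof.
move=> [_ _ /subspace_continuousP cphi] Tt y.
move=> A phiA.
have [[P Q] /= [tP yQ] PQA] := cphi (t, y) (conj Tt I) A phiA.
apply: filterS yQ => z Qz; apply: (PQA (t, z)) => //.
by split=> //; exact: nbhs_singleton tP.
Qed.

Unset Implicit Arguments.

Theorem mainTheorem2 (R : realType) (E : polishMetricType R) (T : set R)
    (hT : T = nat_time R \/ T = real_time R)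
    (d : nat -> measure_display) (Om : forall N, measurableType (d N))
    (P : forall N, probability (Om N) R)
    (Y : forall N : nat, R -> {RV (P N) >-> borel E})
    (K : nat -> R -> R.-pker (borel E) ~> (borel E))
    (Ycadlag : T = real_time R ->
       forall (N : nat) (w : Om N), cadlag (fun t => Y N t w))
    (Ycond : forall (N : nat) (t : R), T t ->
       conditional_law (Y N 0) (Y N t) (K N t))
    (Yfeller : forall N : nat, feller T (K N))
    (phi : R -> E -> E)
    (phiflow : continuous_semiflow T phi)
    (Ycvg : converges_to_semiflow_along_subsequences T
       (fun N => msupport (distribution (P N) (Y N 0))) K phi)
    (Pi : nat -> probability (borel E) R)
    (Pi_inv : forall N : nat,
       invariant_probability T (msupport (distribution (P N) (Y N 0)))
         (K N) (Pi N)) :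
  forall Pi_lim : probability (borel E) R,
    weak_limit_point Pi Pi_lim ->
    msupport Pi_lim `<=` closure (recurrent_set T phi).
Proof.
move=> Pi_lim [s s_incr Pi_cvg].
pose S N := msupport (distribution (P N) (Y N 0)).
have TN (n : nat) : T n%:R.
  by case: hT => ->; [exists n|rewrite /real_time /= ler0n].
have cphi t : T t -> continuous (phi t) := semiflow_continuous phiflow.
have phi_inv t h : T t -> Cb h ->
    \int[Pi_lim]_x h (phi t x) = \int[Pi_lim]_x h x :> R.
  move=> Tt Ch; have [ch [M hM]] := (CbP h).1 Ch.
  have KM n x : `|cond_expectation (K (s n)) t h x| <= M.
    exact: norm_Rintegral_le.
  have KCb n : Cb (cond_expectation (K (s n)) t h).
    by apply/CbP; split; [exact: Yfeller|exists M].
  have hphiCb : Cb (h \o phi t) by apply: Cb_comp => //; exact: cphi.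
  have lim : \int[Pi (s n)]_x cond_expectation (K (s n)) t h x @[n --> \oo]
      --> (\int[Pi_lim]_x (h \o phi t) x : R).
    apply: (continuously_cvg_integral (S := S \o s) Pi_cvg _ _ KCb KM) => //.
    - move=> n; rewrite -[X in measurable X]setCK.
      apply: measurableC; apply: open_borel_measurable.
      by rewrite openC; exact: closed_msupport.
    - by move=> n; have [] := Pi_inv (s n).
    - by move=> x; exact: hM.
    - move=> s' s'_incr y0 y Sy y_y0.
      by apply: (Ycvg (s \o s')) => // m n mn; apply/s_incr/s'_incr.
  have lim' : \int[Pi (s n)]_x cond_expectation (K (s n)) t h x @[n --> \oo]
      --> (\int[Pi_lim]_x h x : R).
    have := Pi_cvg h Ch; apply: cvg_trans; apply: near_eq_cvg.
    by apply: nearW => n; have [_ inv] := Pi_inv (s n); rewrite inv.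
  exact: (cvg_unique _ lim lim').
have [phi0 phiD _] := phiflow.
move=> x x_supp U /= /nbhs_interior Ux.
have oU : open (interior U) by exact: open_interior.
(* [z] is sought in the interior of [U], an open set charged by [Pi_lim]. *)
have [||||z Uz rec] := @Poincare_recurrence _ _ Pi_lim
  (fun n => phi n%:R) _ _ _ _ _ oU (x_supp _ oU (nbhs_singleton Ux)).
- by [].
- by move=> m n y; rewrite natrD phiD.
- by move=> n; exact: cphi.
- move=> n V oV; apply: open_preimage_invariant => //; first exact: cphi.
  by move=> h; exact: phi_inv.
by exists z; split; [exact: integer_recurrence|exact: interior_subset].
Qed.
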